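(* If an interval $[U,V]\subseteq\operatorname{Bip}(\{1,2,\dots,n\})$ is not regular, then the order complex $\triangle([U,V]\setminus\{U,V\})$ is contractible. In particular, the Möbius function value $\mu(U,V)$ vanishes in $\operatorname{Bip}(\{1,2,\dots,n\})$.
   Context: A relation $U\subseteq X\times X$ on a finite set $X$ is bipartitional if both $U$ and $(X\times X)\setminus U$ are transitive. $\operatorname{Bip}(X)$ is the set of bipartitional relations on $X$, partially ordered by inclusion. The order complex $\triangle(Q)$ of a poset $Q$ is the simplicial complex whose vertices are the elements of $Q$ and whose faces are the chains of $Q$. For a bipartitional relation $U$, write $x\sim_U y$ if either both or none of $(x,y)$ and $(y,x)$ belong to $U$; this is an equivalence relation on $X$. An interval $[U,V]\subseteq\operatorname{Bip}(X)$ is called regular if every $x\in X$ satisfying $(x,x)\in V\setminus U$ also satisfies $\{y\in X: x\sim_U y\}=\{y\in X: x\sim_V y\}$. *)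

(* Defs.v *)
From HB Require Import structures.
From mathcomp Require Import all_boot all_order all_algebra.
From mathcomp Require Import all_classical all_reals all_analysis.

Set Implicit Arguments.
Unset Strict Implicit.
Unset Printing Implicit Defensive.

Import Order.TTheory GRing.Theory Num.Theory.
Import numFieldNormedType.Exports.

Section Bip.
Variable X : finType.
Implicit Type U V : {set X * X}.

Definition trans_rel U : bool :=
  [forall x, forall y, forall z,
     ((x, y) \in U) && ((y, z) \in U) ==> ((x, z) \in U)].

Lemma trans_relP U :
  reflect (transitive (fun x y => (x, y) \in U)) (trans_rel U).
Proof.
apply: (iffP forallP) => [tU y x z xy yz | tU x].
  by move: (tU x) => /forallP/(_ y)/forallP/(_ z)/implyP; apply; rewrite xy.
apply/forallP=> y; apply/forallP=> z; apply/implyP=> /andP[].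
exact: tU.
Qed.

Definition bipartitional U : bool := trans_rel U && trans_rel (~: U).

Record bip := MkBip { bip_rel :> {set X * X}; _ : bipartitional bip_rel }.

HB.instance Definition _ := [isSub for bip_rel].
HB.instance Definition _ := [Finite of bip by <:].

Fact bip_display : Order.disp_t. Proof. exact: Order.default_display. Qed.

Definition bip_le (U V : bip) : bool := bip_rel U \subset bip_rel V.

Fact bip_le_refl : reflexive bip_le. Proof. by move=> U; exact: subxx. Qed.

Fact bip_le_anti : antisymmetric bip_le.
Proof. by move=> U V UV; apply/val_inj/eqP; rewrite finset.eqEsubset. Qed.

Fact bip_le_trans : transitive bip_le.
Proof. by move=> V U W; exact: fintype.subset_trans. Qed.

HB.instance Definition _ := Order.Le_isPOrder.Build bip_display bip
  bip_le_refl bip_le_anti bip_le_trans.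

Definition bip_sim U (x y : X) : bool := ((x, y) \in U) == ((y, x) \in U).

Definition regular_interval U V : Prop :=
  forall x : X, (x, x) \in V :\: U ->
    [set y | bip_sim U x y] = [set y | bip_sim V x y].

End Bip.

Section Moebius.
Context {d : Order.disp_t} {P : finPOrderType d}.
Local Open Scope order_scope.

(* The first argument bounds the depth of the recursion; #|P| is enough, since
   the interval below y shrinks at each step (see mobiusE). *)
Fixpoint mobius_rec (k : nat) (x y : P) : int :=
  if k is k'.+1 then
    if x == y then 1%R
    else if x < y then (- \sum_(z | (x <= z < y)%O) mobius_rec k' x z)%R
    else 0%R
  else 0%R.

Definition mobius (x y : P) : int := mobius_rec #|P| x y.

Lemma mobius_rec_stable (k l : nat) (x y : P) :
  (#|[set z : P | (x <= z <= y)%O]| <= k)%N -> (#|[set z : P | (x <= z <= y)%O]| <= l)%N ->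
  mobius_rec k x y = mobius_rec l x y.
Proof.
elim: k l x y => [|k IH] [|l] x y //=.
- rewrite leqn0 cards_eq0 => /eqP I0 _.
  case: ifP => [/eqP xy|_].
    by move/setP/(_ x): I0; rewrite !inE xy lexx.
  case: ifP => // xy.
  by move/setP/(_ x): I0; rewrite !inE lexx ltW.
- move=> _; rewrite leqn0 cards_eq0 => /eqP I0.
  case: ifP => [/eqP xy|_].
    by move/setP/(_ x): I0; rewrite !inE xy lexx.
  case: ifP => // xy.
  by move/setP/(_ x): I0; rewrite !inE lexx ltW.
move=> hk hl; case: ifP => // _; case: ifP => // xy.
congr (- _)%R; apply: eq_bigr => z /andP[xz zy].
have lt_card : (#|[set w : P | (x <= w <= z)%O]| < #|[set w : P | (x <= w <= y)%O]|)%N.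
  apply: proper_card; apply/properP; split.
    apply/fintype.subsetP => w; rewrite !inE => /andP[-> wz] /=.
    exact: le_trans wz (ltW zy).
  exists y; first by rewrite !inE lexx ltW.
  by rewrite !inE (lt_geF zy) andbF.
by apply: IH; rewrite -ltnS; apply: leq_trans lt_card _.
Qed.

Lemma mobiusxx (x : P) : mobius x x = 1%R.
Proof.
rewrite /mobius; have: (0 < #|P|)%N by apply/card_gt0P; exists x.
by case: #|P| => //= k _; rewrite eqxx.
Qed.

Lemma mobiusE (x y : P) : x < y ->
  mobius x y = (- \sum_(z | (x <= z < y)%O) mobius x z)%R.
Proof.
move=> xy; rewrite [LHS](@mobius_rec_stable _ #|P|.+1) ?max_card //.
  by rewrite /= lt_eqF // xy.
exact: leqW (max_card _).
Qed.

End Moebius.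

Section OrderComplex.
Context {d : Order.disp_t} {P : finPOrderType d}.
Local Open Scope order_scope.

Definition is_chain (C : {set P}) : bool :=
  [forall x in C, forall y in C, (x <= y) || (y <= x)].

Definition order_complex (Q : {set P}) : {set {set P}} :=
  [set C : {set P} | (C \subset Q) && is_chain C].

End OrderComplex.

Local Open Scope classical_set_scope.
Local Open Scope ring_scope.

(* Barycentric coordinates: the points of the realization are the convex
   combinations of vertices whose support is a face. On the finite product
   R^T pointwise convergence is the Euclidean topology. *)
Definition realization (R : realType) (T : finType) (K : {set {set T}}) :
    set {ptws T -> R} :=
  [set p | [/\ forall v, 0 <= p v, \sum_v p v = 1
             & finset (fun v => p v != 0) \in K]].

Arguments realization R {T} K.

(* A is contractible as a subspace of E: the identity of A is homotopic, within
   A, to a constant map. In particular A is nonempty. *)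
Definition contractible (R : realType) (E : topologicalType) (A : set E) :
    Prop :=
  exists2 a : E, A a &
  exists h : R * E -> E,
    [/\ {within `[0, 1] `*` A, continuous h},
        forall (t : R) x, t \in `[0, 1] -> A x -> A (h (t, x)),
        forall x, A x -> h (0, x) = x
      & forall x, A x -> h (1, x) = a].

(* Main.v *)
(** Write [x], [y] for a witness of non-regularity: [(x, x)] lies in [V] but not
    in [U], and [x], [y] are equivalent for only one of [U] and [V]. Up to
    complementing all relations, which reverses inclusion, [(x, y)] and [(y, x)]
    are not in [U] while exactly one of them is in [V], say [(x, y)]. Put
    [D = {u | (u, x) \in V}] and [Z = D * (X \ D)]. Then [Z] is bipartitional,
    is contained in [V] but not in [U], and [W \/ Z = V] forces [W = V] for all
    [W <= V]: no pair of [V] enters [D], so joining with [Z] adds nothing inside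
    [D] or outside [D], where [W] therefore agrees with [V]; in particular
    [(u, x) \in W] for all [u \in D], and negative transitivity gives [Z <= W].
    Hence [W <= W \/ Z >= U \/ Z] contracts the open interval to the point
    [U \/ Z], and Weisner's theorem gives [mu(U, V) = 0]. *)

Require Import Defs.
From mathcomp Require Import all_boot all_order all_algebra.
From mathcomp Require Import all_classical all_reals all_analysis.
From mathcomp Require Import ring lra.
Import Order.TTheory GRing.Theory Num.Theory.
Import numFieldNormedType.Exports.

Set Implicit Arguments.
Unset Strict Implicit.
Unset Printing Implicit Defensive.

Local Open Scope classical_set_scope.
Local Open Scope ring_scope.

(** * Contractible spaces of functions *)

Lemma ptws_cvgP {T : choiceType} {Y : uniformType}
    (F : set_system {ptws T -> Y}) (p : {ptws T -> Y}) : Filter F ->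
  (F --> p) <-> (forall w, (q w @[q --> F]) --> p w).
Proof. by move=> FF; exact: (@pointwise_cvgP (discrete_topology T)). Qed.

(** Serves to compose a homotopy that is continuous only within [S'] with a map sending [S] into
    [S']. *)
Lemma cvg_withinP {X Y : topologicalType} (S : set X) (S' : set Y)
    (f : X -> Y) (x : X) :
  {for x, continuous f} -> (forall z, S z -> S' (f z)) ->
  f @ within S (nbhs x) --> within S' (nbhs (f x)).
Proof.
move=> cf SS' N; rewrite /within /= => /cf fN.
apply: (@filterS _ (nbhs x) _ _ _ _ fN) => z fzN Sz; exact: fzN (SS' _ Sz).
Qed.

(* The homotopy runs along the segments from [p] to [r p] for [t <= 1/2] and
   then follows a contraction [G] of [B]; written as a sum it needs no gluing,
   since [G (0, r p) = r p]. *)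
Lemma contractible_deform (R : realType) (T : choiceType)
    (A B : set {ptws T -> R}) (r : {ptws T -> R} -> {ptws T -> R}) :
  continuous r -> B `<=` A -> (forall p, A p -> B (r p)) ->
  (forall (s : R) p, 0 <= s <= 1 -> A p ->
     A (fun w => r p w + s * (p w - r p w))) ->
  contractible R B -> contractible R A.
Proof.
move=> cr BA AB Aseg [a Ba [G [cG BG G0 G1]]].
exists a; first exact: BA.
(* On the unit interval, [psi] falls from 1 to 0 in the first half and steers the segment; [phi]
   rises from 0 to 1 in the second half and steers [G]. *)
pose phi (t : R) := Num.max 0 (2 * t - 1).
pose psi (t : R) := Num.max 0 (1 - 2 * t).
have cphi : continuous phi.
  move=> t; apply: (@continuous_max _ _ (cst 0) (fun t : R => 2 * t - 1)).
    exact: cvg_cst.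
  by apply: cvgB; [apply: cvgM; [exact: cvg_cst|exact: cvg_id]|exact: cvg_cst].
have cpsi : continuous psi.
  move=> t; apply: (@continuous_max _ _ (cst 0) (fun t : R => 1 - 2 * t)).
    exact: cvg_cst.
  by apply: cvgB; [exact: cvg_cst|apply: cvgM; [exact: cvg_cst|exact: cvg_id]].
have phi01 t : t \in `[0, 1] -> phi t \in `[0, 1].
  by rewrite !in_itv /= /phi le_max lexx ge_max ler01 /= => /andP[_]; lra.
have phipsi t : t \in `[0, 1] ->
    (phi t = 0 /\ 0 <= psi t <= 1) \/ psi t = 0.
  rewrite in_itv /= /phi /psi => /andP[t0 t1].
  by case: (leP 0 (2 * t - 1)); case: (leP 0 (1 - 2 * t)); lra.
pose h (z : R * {ptws T -> R}) : {ptws T -> R} :=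
  fun w => G (phi z.1, r z.2) w + psi z.1 * (z.2 w - r z.2 w).
exists h; split.
- apply/subspace_continuousP => -[t p] [t01 Ap] /=.
  have FW : Filter (within (`[0, 1] `*` A) (nbhs (t, p))).
    exact: within_filter.
  have cf1 (Y : topologicalType) (f : R -> Y) : continuous f ->
      f z.1 @[z --> (t, p)] --> f t.
    by move=> cf; exact: (cvg_comp fst f cvg_fst (cf t)).
  have cf2 (Y : topologicalType) (f : {ptws T -> R} -> Y) : continuous f ->
      f z.2 @[z --> (t, p)] --> f p.
    by move=> cf; exact: (cvg_comp snd f cvg_snd (cf p)).
  apply/ptws_cvgP => w; rewrite /h /=; apply: cvgD.
    have /subspace_continuousP/(_ (phi t, r p)) GB := cG.
    have {}GB :
        G @ within (`[0, 1] `*` B) (nbhs (phi t, r p)) --> G (phi t, r p).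
      by apply: GB; split => /=; [exact: phi01|exact: AB].
    have cf : {for (t, p), continuous
        (fun z : R * {ptws T -> R} => (phi z.1, r z.2))}.
      exact: (cvg_pair (cf1 _ _ cphi) (cf2 _ _ cr)).
    have SS' z : (`[0, 1] `*` A) z -> (`[0, 1] `*` B) (phi z.1, r z.2).
      by case=> z1 z2; split; [exact: phi01|exact: AB].
    by have /ptws_cvgP/(_ w) := cvg_comp _ G (cvg_withinP cf SS') GB.
  apply: cvg_within_filter; apply: cvgM; first exact: cf1.
  have cw : continuous (fun q : {ptws T -> R} => q w) by exact: proj_continuous.
  apply: cvgB; first exact: (cf2 R (fun q => q w)).
  apply: (cf2 R (fun q => r q w)) => q.
  exact: (cvg_comp r (fun q : {ptws T -> R} => q w) (cr q) (cw _)).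
- move=> t p t01 Ap; have [[phi0 psi01]|psi0] := phipsi _ t01.
    rewrite /h /= phi0 G0; last exact: AB.
    exact: Aseg.
  have -> : h (t, p) = G (phi t, r p).
    by apply/funext => w; rewrite /h /= psi0 mul0r addr0.
  by apply: BA; apply: BG; [exact: phi01|exact: AB].
- move=> p Ap; apply/funext => w; rewrite /h /=.
  have -> : phi 0 = 0 by rewrite /phi; case: leP; lra.
  have -> : psi 0 = 1 by rewrite /psi; case: leP; lra.
  by rewrite G0 ?mul1r; [lra|exact: AB].
- move=> p Ap; apply/funext => w; rewrite /h /=.
  have -> : phi 1 = 1 by rewrite /phi; case: leP; lra.
  have -> : psi 1 = 0 by rewrite /psi; case: leP; lra.
  by rewrite G1 ?mul0r ?addr0 //; exact: AB.
Qed.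

(** * Removing dominated vertices from an order complex *)

Lemma order_complexP d (P : finPOrderType d) (Q C : {set P}) :
  reflect ({subset C <= Q} /\ {in C &, forall x y, (x >=< y)%O})
          (C \in order_complex Q).
Proof.
rewrite inE; apply: (iffP andP) => -[CQ ch]; split=> //.
- exact/fintype.subsetP.
- by move=> x y xC yC; move: ch => /forall_inP/(_ x xC)/forall_inP/(_ y yC).
- exact/fintype.subsetP.
- by apply/forall_inP => x xC; apply/forall_inP => y yC; exact: ch.
Qed.

(** The realization is one point, the unit mass at [c]. *)
Lemma contractible_order_complex1 (R : realType) d (P : finPOrderType d)
    (c : P) :
  contractible R (realization R (order_complex [set c]%SET)).
Proof.
pose a : {ptws P -> R} := fun w => (w == c)%:R.
have aA : realization R (order_complex [set c]%SET) a.
  split=> [v||]; first exact: ler0n.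
    by rewrite (bigD1 c) //= /a eqxx big1 ?addr0 // => i /negbTE ->.
  have aE w : (w \in [set w | a w != 0]%SET) = (w == c).
    by rewrite inE pnatr_eq0 eqb0 negbK.
  apply/order_complexP; split=> [x|x y]; rewrite !aE ?inE //.
  by move=> /eqP -> /eqP ->; exact: Order.POrderTheory.comparablexx.
have Aa p : realization R (order_complex [set c]%SET) p -> p = a.
  case=> _ sum1 /order_complexP[sub _].
  have p0 w : w != c -> p w = 0.
    by move=> wc; apply: contraNeq wc => pw; have := sub w; rewrite !inE; exact.
  apply/funext => w; rewrite /a; case: eqVneq => [->|/p0 //].
  by rewrite -sum1 (bigD1 c) //= big1 ?addr0 // => i /p0.
exists a => //; exists (cst a); split=> [| |p /Aa -> |] //=.
by apply/subspace_continuousP => x _; exact: cvg_cst.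
Qed.

Section Dominated.
Context (R : realType) (d : Order.disp_t) (P : finPOrderType d).
Variables (Q : {set P}) (v v' : P).
Hypotheses (v'Q : v' \in Q) (v'v : v' != v).
Hypothesis dom : {in Q, forall w, (w >=< v)%O -> (w >=< v')%O}.

(** Moves the fraction [c] of the weight at [v] to [v']. *)
Let slide (c : R) (p : {ptws P -> R}) : {ptws P -> R} :=
  fun w => p w + c * p v * ((w == v')%:R - (w == v)%:R).

(** If [v] has weight, the support is a chain through [v], so by domination it stays a chain when
    [v'] is added; otherwise nothing moves. *)
Let slide_in (c : R) p : 0 <= c <= 1 ->
  realization R (order_complex Q) p ->
  realization R (order_complex Q) (slide c p).
Proof.
move=> /andP[c0 c1] [p0 p1 /order_complexP[pQ pch]].
have cp0 : 0 <= c * p v by rewrite mulr_ge0.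
split=> [w||].
- rewrite /slide; case: eqVneq => [->|_].
    by rewrite (negbTE v'v) subr0 mulr1 addr_ge0.
  case: eqVneq => [->|_]; last by rewrite subr0 mulr0 addr0.
  by rewrite sub0r mulrN1 subr_ge0 ler_piMl.
- have sum1 u : \sum_w (w == u)%:R = 1 :> R.
    by rewrite (bigD1 u) //= eqxx big1 ?addr0 // => i /negbTE ->.
  by rewrite big_split /= -big_distrr /= sumrB !sum1 subrr mulr0 addr0.
have [pv0|pv] := eqVneq (p v) 0.
  have -> : slide c p = p.
    by apply/funext => w; rewrite /slide pv0 mulr0 mul0r addr0.
  exact/order_complexP.
have supp w : slide c p w != 0 -> w = v' \/ p w != 0.
  rewrite /slide; have [->|wv'] := eqVneq w v'; first by left.
  have [-> _|wv] := eqVneq w v; first by right.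
  by rewrite subrr mulr0 addr0; right.
have cmpv w : p w != 0 -> (w >=< v')%O.
  by move=> pw; apply: dom; [apply: pQ|apply: pch]; rewrite inE.
apply/order_complexP; split=> [w|w u]; rewrite !inE.
  by case/supp=> [->//|pw]; apply: pQ; rewrite inE.
move=> /supp[->|pw] /supp[->|pu].
- exact: Order.POrderTheory.comparablexx.
- by rewrite Order.POrderTheory.comparable_sym cmpv.
- exact: cmpv.
- by apply: pch; rewrite inE.
Qed.

(** [slide 1] empties [v], and the segment from [slide 1 p] to [p] consists of partial slides, so
    [contractible_deform] applies. *)
Lemma contractible_dominated :
  contractible R (realization R (order_complex (Q :\ v)%SET)) ->
  contractible R (realization R (order_complex Q)).
Proof.
apply: (contractible_deform (r := slide 1)).
- have cw u : continuous (fun q : {ptws P -> R} => q u).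
    exact: proj_continuous.
  move=> p; apply/(@ptws_cvgP P R (slide 1 @ nbhs p)) => w.
  apply: cvgD; first exact: cw.
  apply: cvgM; last exact: cvg_cst.
  by apply: cvgM; [exact: cvg_cst | exact: cw].
- move=> p [p0 p1 /order_complexP[pQ pch]]; split=> //; apply/order_complexP.
  by split=> // w /pQ; rewrite in_setD1 => /andP[].
- move=> p pA.
  have [p0 p1 /order_complexP[pQ pch]] :
      realization R (order_complex Q) (slide 1 p).
    by apply: slide_in; rewrite ?ler01 ?lexx.
  split=> //; apply/order_complexP; split=> // w wS.
  rewrite in_setD1 pQ // andbT.
  apply: contraTneq wS => ->; rewrite inE negbK /slide eqxx.
  by rewrite [v == v']eq_sym (negbTE v'v) mul1r sub0r mulrN1 subrr.
- move=> s p /andP[s0 s1] pA.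
  have -> : (fun w => slide 1 p w + s * (p w - slide 1 p w)) = slide (1 - s) p.
    by apply/funext => w; rewrite /slide; ring.
  by apply: slide_in; rewrite // subr_ge0 s1 /=; lra.
Qed.

End Dominated.

(** * Closure operators and open intervals *)

Section Interval.
Context (R : realType) (d : Order.disp_t) (P : finPOrderType d).
(** An order complex depends only on comparability, so [le] may be the order or its reverse; the
    theorem uses both. *)
Variable le : rel P.
Hypotheses (le_refl : reflexive le) (le_anti : antisymmetric le).
Hypothesis le_trans : transitive le.
Hypothesis cmpE : forall x y : P, (x >=< y)%O = le x y || le y x.

(* First push the elements not fixed by [f] up to their images, starting from
   the top: above such a maximal element [v] everything is fixed, hence lies
   above [f v], so that [f v] dominates [v]. Then [c] is the bottom element. *)
Lemma contractible_closure (f : P -> P) (c : P) (Q : {set P}) :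
  c \in Q -> f c = c -> {in Q, forall w, f w \in Q} ->
  {in Q &, forall v w, le v w -> le (f v) (f w)} ->
  {in Q, forall w, le w (f w)} -> {in Q, forall w, f (f w) = f w} ->
  {in Q, forall w, le c (f w)} ->
  contractible R (realization R (order_complex Q)).
Proof.
move=> + fc; have [m] := ubnP #|Q|; elim: m Q => // m IH Q Qm.
move=> cQ fQ mono infl idem cf.
have [/eqP -> | Qc] := boolP (Q == [set c]%SET).
  exact: contractible_order_complex1.
(* The deleted vertex must not be the image of another element, so that [f] still acts on what
   remains. *)
suff [v [vQ vc fNv [v' v'Q [v'v dom]]]] : exists v, [/\ v \in Q, v != c,
    {in Q, forall w, w != v -> f w != v} &
    exists2 v', v' \in Q & v' != v /\
      {in Q, forall w, (w >=< v)%O -> (w >=< v')%O}].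
  have sub : {subset (Q :\ v)%SET <= Q}.
    by move=> w; rewrite in_setD1 => /andP[].
  apply: (contractible_dominated v'Q v'v dom); apply: IH.
  - by rewrite -ltnS (leq_trans _ Qm) // ltnS [X in (_ < X)%N](cardsD1 v) vQ.
  - by rewrite in_setD1 eq_sym vc.
  - by move=> w; rewrite !in_setD1 => /andP[wv wQ]; rewrite fNv // fQ.
  - by move=> w u /sub wQ /sub uQ; exact: mono.
  - by move=> w /sub; exact: infl.
  - by move=> w /sub; exact: idem.
  - by move=> w /sub; exact: cf.
have [/existsP[v0 /andP[v0Q fv0]]|] :=
    boolP [exists w, (w \in Q) && (f w != w)].
  (* A minimizer of [up] is maximal among the elements not fixed by [f]. *)
  pose up w := #|[set u in Q | le w u]%SET|.
  have [] := @arg_minnP _ v0 (fun w => (w \in Q) && (f w != w)) up.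
    by rewrite v0Q.
  move=> v /andP[vQ fv] vmin; exists v; split=> //.
  - by apply: contraNneq fv => ->; rewrite fc.
  - by move=> w wQ _; apply: contraNneq fv => <-; rewrite idem.
  exists (f v); first exact: fQ.
  split=> // w wQ; rewrite !cmpE => /orP[wv|vw].
    by rewrite (le_trans wv) ?infl.
  have [fw|fw] := eqVneq (f w) w.
    by rewrite -[X in _ || le _ X]fw mono ?orbT.
  have [->|wv] := eqVneq w v; first by rewrite infl.
  have /vmin : (w \in Q) && (f w != w) by rewrite wQ.
  rewrite leqNgt => /negP[]; apply: proper_card; apply/properP; split.
    apply/fintype.subsetP => u; rewrite !inE => /andP[-> wu] /=.
    exact: le_trans wu.
  exists v; rewrite !inE vQ ?le_refl //=.
  by apply: contra wv => wv; apply/eqP/le_anti; rewrite wv vw.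
rewrite negb_exists => /forallP fixed.
have fE w : w \in Q -> f w = w.
  by move=> wQ; move: (fixed w); rewrite wQ negbK => /eqP.
have [v /andP[vQ vc]] : exists v, (v \in Q) && (v != c).
  apply/existsP; apply: contraR Qc; rewrite negb_exists => /forallP Qc.
  apply/eqP/setP => w; rewrite inE; apply/idP/eqP => [wQ|-> //].
  by move: (Qc w); rewrite wQ negbK => /eqP.
exists v; split=> //; first by move=> w /fE ->.
exists c => //; split; first by rewrite eq_sym.
by move=> w wQ _; rewrite cmpE -{2}(fE w) ?cf ?orbT.
Qed.

(** By [jP], [j W] is the join of [W] and [z], so [j] is a closure operator. It preserves the open
    interval: [j W] lies above [z], which [U] does not, and it reaches [V] only from [V]. The
    contraction ends at [j U]. *)
Lemma contractible_interval (U V z : P) (j : P -> P) :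
  (forall W T, le (j W) T = le W T && le z T) ->
  le U V -> le z V -> ~~ le z U ->
  (forall W, le W V -> j W = V -> W = V) ->
  contractible R (realization R (order_complex
    [set W | [&& le U W, le W V, W != U & W != V]]%SET)).
Proof.
move=> jP leUV zV zU jV.
have Wj W : le W (j W) by have := le_refl (j W); rewrite jP => /andP[].
have zj W : le z (j W) by have := le_refl (j W); rewrite jP => /andP[].
have jle W W' : le W W' -> le (j W) (j W').
  by move=> WW'; rewrite jP zj (le_trans WW').
have jj W : j (j W) = j W by apply: le_anti; rewrite Wj jP le_refl zj.
have NjU W : j W != U by apply: contraNneq zU => <-.
have UV : U != V by apply: contraNneq zU => ->.
apply: (@contractible_closure j (j U)).
- rewrite inE Wj jP leUV zV NjU /=; apply: contra UV => /eqP /jV -> //.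
- exact: jj.
- move=> W; rewrite !inE => /and4P[UW WV _ WneV].
  rewrite NjU (le_trans UW) //= jP WV zV /=.
  by apply: contra WneV => /eqP/jV ->.
- by move=> W T _ _; exact: jle.
- by move=> W _; exact: Wj.
- by move=> W _; exact: jj.
- by move=> W; rewrite inE => /andP[UW _]; exact: jle.
Qed.

End Interval.

(** * Vanishing of the Moebius function *)

Section MoebiusVanishing.
Context (d : Order.disp_t) (P : finPOrderType d).
Implicit Types U V W T z : P.

Lemma lt_ind (K : P -> Prop) :
  (forall x, (forall y, (y < x)%O -> K y) -> K x) -> forall x, K x.
Proof.
move=> step x; have [m] := ubnP #|[set w : P | (w < x)%O]%SET|.
elim: m x => // m IH x xm; apply: step => y yx; apply: IH.
rewrite -ltnS; apply: leq_trans xm; rewrite ltnS; apply: proper_card.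
apply/properP; split; last by exists y; rewrite !inE ?ltxx.
by apply/fintype.subsetP => w; rewrite !inE => /lt_trans; exact.
Qed.

Lemma sum_mobius U T : (U < T)%O -> \sum_(W | (U <= W <= T)%O) mobius U W = 0.
Proof.
move=> UT; rewrite (bigD1 T) ?lexx ?ltW //= mobiusE // addrC.
apply/eqP; rewrite subr_eq0; apply/eqP/eq_bigl => W.
by rewrite lt_neqAle -!andbA [(W != T) && _]andbC.
Qed.

(** Weisner's theorem: the values [mobius U W] over all [W] with a given join with [z] sum to
    zero. *)
Lemma mobius_join_eq0 U V z (j : P -> P) :
  (forall W T, (j W <= T)%O = (W <= T)%O && (z <= T)%O) ->
  (U <= V)%O -> (z <= V)%O -> ~~ (z <= U)%O ->
  (forall W, (W <= V)%O -> j W = V -> W = V) -> mobius U V = 0.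
Proof.
move=> jP UV zV zU jV.
have Wj W : (W <= j W)%O by have := lexx (j W); rewrite jP => /andP[].
have zj W : (z <= j W)%O by have := lexx (j W); rewrite jP => /andP[].
(* For [T = V] the sum has the single term [W = V]. *)
suff N0 T : (U <= T)%O -> (z <= T)%O ->
    \sum_(W | (U <= W)%O && (j W == T)) mobius U W = 0.
  rewrite -[RHS](N0 V UV zV) (big_pred1 V) // => W /=.
  apply/andP/eqP => [[_ /eqP jWV]|->]; first by apply: jV; rewrite -?jWV ?Wj.
  by split=> //; rewrite eq_le Wj jP lexx zV.
elim/lt_ind: T => T IH UT zT.
have UltT : (U < T)%O by rewrite lt_neqAle UT andbT; apply: contraNneq zU => ->.
have := sum_mobius UltT.
(* The zero sum over the interval from [U] to [T] is grouped by the value of [j]; the groups below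
   [T] vanish by induction, which leaves the group of [T]. *)
rewrite (partition_big j (fun T' => [&& U <= T', z <= T' & T' <= T]%O)) /=;
  last first.
  by move=> W /andP[UW WT]; rewrite (le_trans UW) ?Wj // zj jP WT zT.
rewrite (bigD1 T) ?UT ?zT ?lexx //= [X in _ + X]big1 ?addr0.
  move=> S0; rewrite -[RHS]S0; apply: eq_bigl => W.
  case: eqVneq => [jWT|]; rewrite ?andbF // !andbT.
  by rewrite -jWT Wj andbT.
move=> T' /andP[/and3P[UT' zT' T'T] T'neT].
rewrite -[RHS](IH T') ?lt_neqAle ?T'neT //; apply: eq_bigl => W.
case: eqVneq => [jWT|]; rewrite ?andbF // !andbT.
by rewrite (le_trans (Wj W)) ?jWT ?andbT.
Qed.

(** The recursion for [mobius] descends in its upper argument, so the dual case gets its own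
    induction, over all [W] not below [y]. In the zero sum from [U] to [W], the terms below [y] fill
    the interval up to [m W] and cancel; of the others, all but [W] vanish by induction. *)
Lemma mobius_meet_eq0 U V y (m : P -> P) :
  (forall W T, (T <= m W)%O = (T <= W)%O && (T <= y)%O) ->
  (U <= V)%O -> (U <= y)%O -> ~~ (V <= y)%O ->
  (forall W, (U <= W)%O -> m W = U -> W = U) -> mobius U V = 0.
Proof.
move=> mP UV Uy Vy mU; elim/lt_ind: V UV Vy => W IH UW Wy.
have WneU : W != U by apply: contraNneq Wy => ->.
have UltW : (U < W)%O by rewrite lt_neqAle UW eq_sym WneU.
have UltmW : (U < m W)%O.
  by rewrite lt_neqAle mP UW Uy !andbT eq_sym; apply: contra WneU => /eqP/mU ->.
have := sum_mobius UltW; rewrite (bigID (fun T => T <= y)%O) /=.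
rewrite (eq_bigl (fun T => (U <= T <= m W)%O)); last first.
  by move=> T; rewrite mP andbA.
rewrite sum_mobius // add0r (bigD1 W) ?UW ?lexx //= big1 ?addr0 //.
move=> T /andP[/andP[/andP[UT TW] Ty] TneW].
by apply: IH; rewrite // lt_neqAle TneW.
Qed.

End MoebiusVanishing.

(** * The lattice of bipartitional relations *)

Section BipLattice.
Variable X : finType.
Implicit Types U V W Z T : bip X.

Lemma bip_trans W x y z : (x, y) \in W -> (y, z) \in W -> (x, z) \in W.
Proof. by case: W => W /= /andP[/trans_relP tW _]; exact: tW. Qed.

Lemma bip_cotrans W x y z : (x, z) \in W -> (x, y) \in W \/ (y, z) \in W.
Proof.
case: W => W /= /andP[_ /trans_relP tW] xz; apply/orP.
move: (tW y x z); rewrite !inE xz.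
by case: (_ \in W) => //=; case: (_ \in W) => // /(_ isT isT).
Qed.

Definition bip_compl_rel W : {set X * X} := (~: W)%SET.

Lemma bip_compl_subproof W : bipartitional (bip_compl_rel W).
Proof.
by rewrite /bipartitional /bip_compl_rel finset.setCK andbC; case: W.
Qed.

(** An order-reversing involution, which turns joins into meets. *)
Definition bip_compl W : bip X := MkBip (bip_compl_subproof W).

Lemma in_bip_compl W p : (p \in bip_compl W) = (p \notin W).
Proof. exact: finset.in_setC. Qed.

Lemma bip_complK : involutive bip_compl.
Proof. by move=> W; apply/val_inj; exact: finset.setCK. Qed.

Lemma bip_leP U V : reflect (forall p, p \in U -> p \in V) (U <= V)%O.
Proof. exact: fintype.subsetP. Qed.

Lemma bip_leC U V : (bip_compl U <= bip_compl V)%O = (V <= U)%O.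
Proof. exact: finset.setCS. Qed.

(** The transitive closure of the union, encoded as an intersection of transitive relations so that
    minimality is immediate. *)
Definition bip_join_rel W Z : {set X * X} :=
  [set p | [forall S : {set X * X},
     [&& trans_rel S, W \subset S & Z \subset S] ==> (p \in S)]]%SET.

Lemma bip_join_min W Z (S : {set X * X}) :
  trans_rel S -> W \subset S -> Z \subset S -> bip_join_rel W Z \subset S.
Proof.
move=> tS WS ZS; apply/fintype.subsetP => p; rewrite inE.
by move=> /forallP/(_ S); rewrite tS WS ZS.
Qed.

Lemma sub_bip_joinl W Z : W \subset bip_join_rel W Z.
Proof.
apply/fintype.subsetP => p pW; rewrite inE; apply/forallP => S.
by apply/implyP => /and3P[_ /fintype.subsetP + _]; exact.
Qed.

Lemma sub_bip_joinr W Z : Z \subset bip_join_rel W Z.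
Proof.
apply/fintype.subsetP => p pW; rewrite inE; apply/forallP => S.
by apply/implyP => /and3P[_ _ /fintype.subsetP]; exact.
Qed.

Lemma bip_join_rel_trans W Z : trans_rel (bip_join_rel W Z).
Proof.
apply/trans_relP => y x z; rewrite !inE => /forallP xy /forallP yz.
apply/forallP => S; apply/implyP => SWZ.
move: (xy S) (yz S); rewrite SWZ /=; case/and3P: SWZ => /trans_relP tS _ _.
exact: tS.
Qed.

(* With [y] fixed, the pairs [(a, b)] of the transitive closure [J] such that
   [(a, y)] or [(y, b)] is in [J] form a transitive relation containing [W] and
   [Z], hence are all of [J]. *)
Lemma bip_join_subproof W Z : bipartitional (bip_join_rel W Z).
Proof.
have := bip_join_rel_trans W Z; have := @bip_join_min W Z.
have := fintype.subsetP (sub_bip_joinl W Z).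
have := fintype.subsetP (sub_bip_joinr W Z).
move: (bip_join_rel W Z) => J ZJ WJ Jmin tJ; rewrite /bipartitional tJ /=.
move/trans_relP: tJ => tJ; apply/trans_relP => y x z.
rewrite !finset.in_setC => xyJ yzJ; apply/negP => xzJ.
pose S := [set p in J | ((p.1, y) \in J) || ((y, p.2) \in J)]%SET.
suff /fintype.subsetP/(_ _ xzJ) : J \subset S.
  by rewrite inE /= (negbTE xyJ) (negbTE yzJ) andbF.
apply: Jmin.
- apply/trans_relP => b a c; rewrite !inE /=.
  move=> /andP[ab abS] /andP[bc _]; rewrite (tJ _ _ _ ab bc) /=.
  by case/orP: abS => [-> //|yb]; rewrite (tJ _ _ _ yb bc) orbT.
- apply/fintype.subsetP => -[a b] ab; rewrite inE /= WJ //=.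
  by case: (bip_cotrans y ab) => /WJ ->; rewrite ?orbT.
- apply/fintype.subsetP => -[a b] ab; rewrite inE /= ZJ //=.
  by case: (bip_cotrans y ab) => /ZJ ->; rewrite ?orbT.
Qed.

Definition bip_join W Z : bip X := MkBip (bip_join_subproof W Z).

Lemma bip_joinP W Z T : (bip_join W Z <= T)%O = (W <= T)%O && (Z <= T)%O.
Proof.
apply/idP/andP => [JT|[WT ZT]].
  split; apply: le_trans JT; [exact: sub_bip_joinl|exact: sub_bip_joinr].
by apply: bip_join_min => //; case: T {WT ZT} => T /= /andP[].
Qed.

Definition bip_meet W Y := bip_compl (bip_join (bip_compl W) (bip_compl Y)).

Lemma bip_meetP W Y T : (T <= bip_meet W Y)%O = (T <= W)%O && (T <= Y)%O.
Proof.
rewrite -[T]bip_complK bip_leC bip_joinP.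
by rewrite -![(bip_compl (bip_compl T) <= _)%O]bip_leC !bip_complK.
Qed.

(** * Cuts and non-regular intervals *)

Lemma bip_cut_subproof (D : {set X}) : bipartitional (finset.setX D (~: D)%SET).
Proof.
apply/andP; split; apply/trans_relP => y x z; rewrite !inE /=.
  by move=> /andP[_ /negbTE ->].
by case: (x \in D); case: (y \in D) => //=; case: (z \in D).
Qed.

Definition bip_cut (D : {set X}) : bip X := MkBip (bip_cut_subproof D).

Lemma in_bip_cut D x y : ((x, y) \in bip_cut D) = (x \in D) && (y \notin D).
Proof. by rewrite !inE. Qed.

(* No pair of [V] leads from outside [D] into [D], so joining with the cut
   changes nothing inside [D] nor outside it; the second hypothesis then recovers
   all pairs of the cut from these two restrictions, by negative transitivity. *)
Lemma bip_cut_join_top V (D : {set X}) :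
  (forall x y, (x, y) \in V -> y \in D -> x \in D) ->
  (forall x y, x \in D -> y \notin D ->
     (exists2 x', x' \in D & (x, x') \in V) \/
     (exists2 y', y' \notin D & (y', y) \in V)) ->
  (bip_cut D <= V)%O /\
  forall W, (W <= V)%O -> bip_join W (bip_cut D) = V -> W = V.
Proof.
move=> closed linked; split.
  apply/bip_leP => -[x y]; rewrite in_bip_cut => /andP[xD yD].
  have [[x' x'D xx']|[y' y'D yy']] := linked x y xD yD.
    case: (bip_cotrans y xx') => // yx'.
    by rewrite (closed _ _ yx' x'D) in yD.
  case: (bip_cotrans x yy') => // y'x.
  by rewrite (closed _ _ y'x xD) in y'D.
move=> W WV JV; apply/le_anti; rewrite WV /=; move/bip_leP: WV => WV.
(* The pairs that do not enter [D] and that lie in [W] if both ends are on the same side: a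
   transitive relation containing [W] and the cut, hence [V]. *)
pose S := [set p : X * X | ((p.2 \in D) ==> (p.1 \in D)) &&
  (((p.1 \in D) == (p.2 \in D)) ==> (p \in W))]%SET.
have /fintype.subsetP VS : V \subset S.
  rewrite -JV; apply: bip_join_min.
  - apply/trans_relP => b a c; rewrite !inE /=.
    have := @bip_trans W a b c.
    case: (a \in D); case: (b \in D); case: (c \in D) => //=; auto.
  - apply/fintype.subsetP => -[a b] ab; rewrite !inE /= ab implybT andbT.
    by apply/implyP; exact: closed (WV _ ab).
  - by apply/fintype.subsetP => -[a b]; rewrite !inE /= => /andP[-> /negbTE ->].
have VW a b : (a \in D) = (b \in D) -> (a, b) \in V -> (a, b) \in W.
  by move=> abD /VS; rewrite inE /= abD eqxx => /andP[_].
apply/bip_leP => -[a b] abV.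
have [abD|abD] := eqVneq (a \in D) (b \in D); first exact: VW.
have [aD bD] : a \in D /\ b \notin D.
  move: abD (closed _ _ abV).
  by case: (a \in D); case: (b \in D) => // _ /(_ isT).
(* The link stays on one side, so it is in [W]. Negative transitivity at the other endpoint gives
   either [(a, b)] or a pair entering [D], which is excluded. *)
have [[x' x'D xx']|[y' y'D yy']] := linked a b aD bD.
  have /(bip_cotrans b)[//|/WV bx'] : (a, x') \in W by apply: VW; rewrite // aD.
  by rewrite (closed _ _ bx' x'D) in bD.
have /(bip_cotrans a)[/WV y'a|//] : (y', b) \in W.
  by apply: VW; rewrite // (negbTE bD) (negbTE y'D).
by rewrite (closed _ _ y'a aD) in y'D.
Qed.

(** The cut separates [x] from [y] and so contains a pair outside [U]; since [(x, x)] is in [V], the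
    point [x] itself provides all links. *)
Lemma bip_cut_exists U V x y : (x, x) \in V -> (x, y) \notin U ->
  (y, x) \notin U -> ((x, y) \in V) != ((y, x) \in V) ->
  exists Z, [/\ (Z <= V)%O, ~~ (Z <= U)%O &
    forall W, (W <= V)%O -> bip_join W Z = V -> W = V].
Proof.
move=> xxV xyU yxU; have [xyV|xyV] /= := boolP ((x, y) \in V) => yxV.
  pose D := [set u | (u, x) \in V]%SET.
  have [||ZV top] := @bip_cut_join_top V D.
  - by move=> u w; rewrite !inE; exact: bip_trans.
  - by move=> u w; rewrite !inE => ux _; left; exists x; rewrite ?inE.
  exists (bip_cut D); split=> //; apply: contra xyU => /bip_leP; apply.
  by rewrite in_bip_cut !inE xxV; move: yxV; case: (_ \in V).
(* Now [(y, x)] is the pair in [V], and [x] lies outside [D], so the links are on that side. *)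
pose D := [set u | (x, u) \notin V]%SET.
have [||ZV top] := @bip_cut_join_top V D.
- move=> u w uw; rewrite !inE; apply: contra => xu; exact: bip_trans xu uw.
- move=> u w; rewrite !inE negbK => _ xw.
  by right; exists x; rewrite ?inE ?negbK.
exists (bip_cut D); split=> //; apply: contra yxU => /bip_leP; apply.
by rewrite in_bip_cut !inE xyV negbK.
Qed.

(** If the witnesses are equivalent for [U], a cut is taken for [V]; otherwise they are equivalent
    for [V], and the cut is taken for the complement of [U] and complemented back. *)
Lemma nonregularP U V : (U <= V)%O -> ~ regular_interval U V ->
  (exists Z, [/\ (Z <= V)%O, ~~ (Z <= U)%O &
     forall W, (W <= V)%O -> bip_join W Z = V -> W = V]) \/
  (exists Y, [/\ (U <= Y)%O, ~~ (V <= Y)%O &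
     forall W, (U <= W)%O -> bip_meet W Y = U -> W = U]).
Proof.
move=> UV nreg.
have [x [y [xxV xxU simN]]] : exists x y, [/\ (x, x) \in V, (x, x) \notin U &
    bip_sim U x y != bip_sim V x y].
  apply: contrapT => none; apply: nreg => x; rewrite inE => /andP[xxU xxV].
  apply/setP => y; rewrite !inE; apply: contrapT => /eqP simN.
  by apply: none; exists x, y.
(* Thus equivalence for [U] means that neither pair is in [U], and equivalence for [V] that both are
   in [V]. *)
have Unn : ~~ (((x, y) \in U) && ((y, x) \in U)).
  by apply: contra xxU => /andP[]; exact: bip_trans.
have Vpp : ((x, y) \in V) || ((y, x) \in V).
  by case: (bip_cotrans y xxV) => ->; rewrite ?orbT.
have [simU|simU] := boolP (bip_sim U x y).
  left; apply: (@bip_cut_exists _ _ x y) => //.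
  - by move: simU Unn; rewrite /bip_sim; do 2 case: (_ \in U).
  - by move: simU Unn; rewrite /bip_sim; do 2 case: (_ \in U).
  - by move: simN; rewrite simU eq_sym eqb_id.
right.
have simV : bip_sim V x y by move: simN simU; case: bip_sim; case: bip_sim.
have [||||Z [ZV ZU top]] := @bip_cut_exists (bip_compl V) (bip_compl U) x y.
- by rewrite in_bip_compl.
- by move: simV Vpp; rewrite in_bip_compl /bip_sim; do 2 case: (_ \in V).
- by move: simV Vpp; rewrite in_bip_compl /bip_sim; do 2 case: (_ \in V).
- by move: simU; rewrite !in_bip_compl /bip_sim; do 2 case: (_ \in U).
exists (bip_compl Z); split.
- by rewrite -bip_leC bip_complK.
- by rewrite -bip_leC bip_complK.
move=> W UW mW; apply: (can_inj bip_complK); apply: top.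
  by rewrite bip_leC.
by rewrite -mW /bip_meet !bip_complK.
Qed.

End BipLattice.

Theorem theorem10p4 (R : realType) (n : nat) (U V : bip 'I_n)
    (leUV : (U <= V)%O) (nreg : ~ regular_interval U V) :
  contractible R
    (realization R (order_complex ([set W in `[U, V]%O] :\: [set U; V])%SET))
  /\ mobius U V = 0%R.
Proof.
have -> : ([set W in `[U, V]%O] :\: [set U; V])%SET =
    [set W | [&& (U <= W)%O, (W <= V)%O, W != U & W != V]]%SET.
  apply/setP => W; rewrite !inE subitvE !bnd_simp negb_or.
  by rewrite [LHS]andbC -andbA.
have [[Z [ZV ZU top]]|[Y [UY YV bot]]] := nonregularP leUV nreg; split.
- have jP W T := bip_joinP W Z T.
  apply: (contractible_interval R (le := <=%O) _ _ _ _ jP) => //.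
  + exact: le_anti.
  + exact: le_trans.
- by apply: (mobius_join_eq0 (fun W T => bip_joinP W Z T)).
(* The same open interval, read from [V] down to [U] for the reversed order, in which the meet is a
   join. *)
- have -> : [set W | [&& (U <= W)%O, (W <= V)%O, W != U & W != V]]%SET =
      [set W | [&& (V >= W)%O, (W >= U)%O, W != V & W != U]]%SET.
    by apply/setP => W; rewrite !inE andbCA [(W != U) && _]andbC.
  have mP W T := bip_meetP W Y T.
  apply: (contractible_interval R (le := >=%O) _ _ _ _ mP) => //.
  + by move=> W; exact: lexx.
  + by move=> W T; rewrite andbC; exact: le_anti.
  + by move=> T W S WT TS; exact: le_trans TS WT.
  + by move=> W T; rewrite orbC.
- by apply: (mobius_meet_eq0 (fun W T => bip_meetP W Y T)).
Qed.
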